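(* Let $\mu$ be a compactly supported probability measure with moment series $M_\mu(z)=\sum_{k\ge1}m_kz^k$ and $R$-series $R_\mu(z)=\sum_{k\ge1}\kappa_kz^k$. For every $m\ge1$, $$[coef_m](M_\mu)=\sum_{k=1}^{m}[coef_k](R_\mu)\,[coef_{m-k}]\big((1+M_\mu)^k\big).$$
   Context: $[coef_j](f)$ denotes the coefficient of $z^j$ in the power series $f$ ($j\ge0$). $m_k$ is the $k$-th moment of $\mu$. The free cumulants $(\kappa_k)_{k\ge1}$ are determined by the moment-cumulant formula $m_k=\sum_{\pi\in NC(k)}\prod_{B\in\pi}\kappa_{|B|}$ for all $k\ge1$, where $NC(k)$ is the set of noncrossing partitions of $\{1,\dots,k\}$. *)

(* Defs.v *)
From HB Require Import structures.
From mathcomp Require Import all_boot all_order all_algebra.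
From mathcomp Require Import all_classical all_reals all_analysis.

Set Implicit Arguments.
Unset Strict Implicit.
Unset Printing Implicit Defensive.

Import Order.TTheory GRing.Theory Num.Theory.
Import numFieldNormedType.Exports.
Local Open Scope ring_scope.

(* Formal power series in one variable, with the Cauchy product.  A record
   rather than an alias of nat -> R, so that the pointwise ring structure on
   functions is not inferred. *)
Record power_series (R : Type) := PowerSeries { coef : nat -> R }.

HB.instance Definition _ (R : Type) := gen_eqMixin (power_series R).
HB.instance Definition _ (R : Type) := gen_choiceMixin (power_series R).

Section PowerSeriesRing.
Variable R : comNzRingType.
Implicit Types f g h : power_series R.

Lemma power_seriesP f g : (forall n, coef f n = coef g n) <-> f = g.
Proof.
split=> [|-> //]; case: f => f; case: g => g /= fg.
by congr PowerSeries; apply/funext.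
Qed.

Definition ps_zero : power_series R := PowerSeries (fun=> 0).
Definition ps_opp f := PowerSeries (fun n => - coef f n).
Definition ps_add f g := PowerSeries (fun n => coef f n + coef g n).
Definition ps_one : power_series R := PowerSeries (fun n => (n == 0%N)%:R).
Definition ps_mul f g :=
  PowerSeries (fun n => \sum_(i < n.+1) coef f i * coef g (n - i)%N).

Lemma ps_addA : associative ps_add.
Proof. by move=> f g h; apply/power_seriesP => n /=; rewrite addrA. Qed.
Lemma ps_addC : commutative ps_add.
Proof. by move=> f g; apply/power_seriesP => n /=; rewrite addrC. Qed.
Lemma ps_add0 : left_id ps_zero ps_add.
Proof. by move=> f; apply/power_seriesP => n /=; rewrite add0r. Qed.
Lemma ps_addN : left_inverse ps_zero ps_opp ps_add.
Proof. by move=> f; apply/power_seriesP => n /=; rewrite addNr. Qed.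

HB.instance Definition _ :=
  GRing.isZmodule.Build (power_series R) ps_addA ps_addC ps_add0 ps_addN.

Let trunc N f : {poly R} := \poly_(i < N) coef f i.

Let trunc_mul N f g n : (n < N)%N ->
  (trunc N f * trunc N g)`_n = coef (ps_mul f g) n.
Proof.
move=> nN; rewrite coefM; apply: eq_bigr => i _; rewrite !coef_poly.
by rewrite (leq_ltn_trans _ nN) 1?(leq_ltn_trans (leq_subr _ _) nN) // -ltnS.
Qed.

Lemma ps_mulA : associative ps_mul.
Proof.
move=> f g h; apply/power_seriesP => n.
have E f1 g1 : forall k : nat, (k < n.+1)%N ->
  (trunc n.+1 (ps_mul f1 g1))`_k = (trunc n.+1 f1 * trunc n.+1 g1)`_k.
  by move=> k kn; rewrite coef_poly kn trunc_mul.
rewrite -!(@trunc_mul n.+1) // !coefM.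
transitivity (trunc n.+1 f * (trunc n.+1 g * trunc n.+1 h))`_n.
  by rewrite coefM; apply: eq_bigr => i _; rewrite E // ltnS leq_subr.
by rewrite mulrA coefM; apply: eq_bigr => i _; rewrite E.
Qed.

Lemma ps_mulC : commutative ps_mul.
Proof.
by move=> f g; apply/power_seriesP => n; rewrite -!(@trunc_mul n.+1) // mulrC.
Qed.

Lemma ps_mul1 : left_id ps_one ps_mul.
Proof.
move=> f; apply/power_seriesP => n /=.
rewrite big_ord_recl /= mul1r subn0 big1 ?addr0 // => i _.
by rewrite mul0r.
Qed.

Lemma ps_mulDl : left_distributive ps_mul ps_add.
Proof.
move=> f g h; apply/power_seriesP => n /=; rewrite -big_split.
by apply: eq_bigr => i _; rewrite mulrDl.
Qed.

Lemma ps_one_neq0 : ps_one != 0.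
Proof.
apply/eqP => /power_seriesP /(_ 0%N) /= /eqP.
by rewrite oner_eq0.
Qed.

HB.instance Definition _ := GRing.Zmodule_isComNzRing.Build (power_series R)
  ps_mulA ps_mulC ps_mul1 ps_mulDl ps_one_neq0.

End PowerSeriesRing.

Definition noncrossing (k : nat) (P : {set {set 'I_k}}) : bool :=
  [forall A in P, forall B in P,
   forall a in A, forall b in B, forall c in A, forall d in B,
     [&& a < b, b < c & c < d]%N ==> (A == B)].

Lemma noncrossingP (k : nat) (P : {set {set 'I_k}}) :
  reflect (forall A B, A \in P -> B \in P ->
             forall a b c d : 'I_k, a \in A -> b \in B -> c \in A -> d \in B ->
               (a < b)%N -> (b < c)%N -> (c < d)%N -> A = B)
          (noncrossing P).
Proof.
apply: (iffP forall_inP) => [H A B AP BP a b c d aA bB cA dB ab bc cd|H A AP].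
  move: (H A AP) => /forall_inP/(_ B BP)/forall_inP/(_ a aA)/forall_inP.
  move=> /(_ b bB)/forall_inP/(_ c cA)/forall_inP/(_ d dB)/implyP.
  by rewrite ab bc cd => /(_ isT)/eqP.
apply/forall_inP => B BP; apply/forall_inP => a aA; apply/forall_inP => b bB.
apply/forall_inP => c cA; apply/forall_inP => d dB.
by apply/implyP => /and3P[ab bc cd]; apply/eqP; exact: (H A B AP BP a b c d).
Qed.

(* Noncrossing partitions of 'I_k = {0, ..., k-1}, i.e. of {1, ..., k} up to
   the order-preserving shift. *)
Definition NC (k : nat) : {set {set {set 'I_k}}} :=
  [set P | finset.partition P [set: 'I_k] && noncrossing P].

(* Value at index 0 is irrelevant: only the indices k >= 1 are constrained. *)
Definition moment_cumulant (R : comNzRingType) (m kappa : nat -> R) : Prop :=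
  forall k, (1 <= k)%N -> m k = \sum_(P in NC k) \prod_(B in P) kappa #|B|.

Section FreeCumulants.
Variable R : comNzRingType.

Lemma setT_in_NC k : (0 < k)%N -> [set [set: 'I_k]] \in NC k.
Proof.
move=> k0; rewrite inE; apply/andP; split.
  apply/and3P; split; first by rewrite cover1.
    by apply/finset.trivIsetP => A B /set1P -> /set1P ->; rewrite eqxx.
  by apply/set1P => /setP /(_ (Ordinal k0)); rewrite !inE.
do 2![apply/forall_inP => ? /set1P ->].
do 4![apply/forall_inP => ? _].
by rewrite eqxx implybT.
Qed.

Lemma NC_block_lt k (P : {set {set 'I_k}}) (B : {set 'I_k}) :
  P \in NC k -> P != [set [set: 'I_k]] -> B \in P -> (#|B| < k)%N.
Proof.
rewrite inE => /andP[/and3P[_ /finset.trivIsetP tP P0] _] PT BP.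
have Bk : (#|B| <= k)%N by rewrite -[leqRHS]card_ord max_card.
rewrite ltn_neqAle Bk andbT; apply: contra PT => /eqP BT.
have {}BT : B = [set: 'I_k].
  by apply/eqP; rewrite eqEcard finset.subsetT finset.cardsT card_ord BT leqnn.
rewrite finset.eqEsubset finset.sub1set -BT BP andbT; apply/fintype.subsetP => A AP.
rewrite inE; apply/eqP; apply: contraNeq P0 => AB.
move: (tP _ _ AP BP AB); rewrite BT -finset.setI_eq0 finset.setIT => /eqP A0.
by rewrite -A0.
Qed.

Lemma NC_sumE k (kappa : nat -> R) : (0 < k)%N ->
  \sum_(P in NC k) \prod_(B in P) kappa #|B| =
  kappa k + \sum_(P in NC k | P != [set [set: 'I_k]]) \prod_(B in P) kappa #|B|.
Proof.
move=> k0; rewrite (bigD1 _ (setT_in_NC k0)) /=.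
by rewrite big_set1 finset.cardsT card_ord.
Qed.

Lemma eq_NC_rest k (kappa1 kappa2 : nat -> R) :
  (forall j, (0 < j < k)%N -> kappa1 j = kappa2 j) ->
  \sum_(P in NC k | P != [set [set: 'I_k]]) \prod_(B in P) kappa1 #|B| =
  \sum_(P in NC k | P != [set [set: 'I_k]]) \prod_(B in P) kappa2 #|B|.
Proof.
move=> eq12; apply: eq_bigr => P /andP[PN PT]; apply: eq_bigr => B BP.
apply: eq12; rewrite (NC_block_lt PN PT BP) andbT card_gt0.
move: PN; rewrite inE => /andP[/and3P[_ _ P0] _].
by apply: contraNneq P0 => <-.
Qed.

(* The moment-cumulant formula does determine (kappa_k)_(k >= 1). *)
Lemma moment_cumulant_uniq (m kappa1 kappa2 : nat -> R) :
  moment_cumulant m kappa1 -> moment_cumulant m kappa2 ->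
  forall k, (1 <= k)%N -> kappa1 k = kappa2 k.
Proof.
move=> h1 h2; elim/ltn_ind => k IH k0; have := h1 k k0.
rewrite (h2 k k0) !NC_sumE // (@eq_NC_rest k kappa1 kappa2); last first.
  by move=> j /andP[j0 jk]; apply: IH.
by move/addIr.
Qed.

Lemma moment_cumulant_ex (m : nat -> R) :
  exists kappa : nat -> R, moment_cumulant m kappa.
Proof.
pose next k (s : seq R) := m k -
  \sum_(P in NC k | P != [set [set: 'I_k]]) \prod_(B in P) s`_#|B|.
pose fix K n := if n is n'.+1 then rcons (K n') (next n'.+1 (K n')) else [:: 0].
have sK n : size (K n) = n.+1 by elim: n => //= n IH; rewrite size_rcons IH.
have nK n d : (K (n + d)%N)`_n = (K n)`_n.
  elim: d => [|d IH]; first by rewrite addn0.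
  by rewrite addnS /= nth_rcons sK ltnS leq_addr.
pose kappa n := (K n)`_n; exists kappa => -[//|k] _.
rewrite NC_sumE // {1}/kappa /= nth_rcons sK ltnn eqxx /next.
rewrite (@eq_NC_rest _ (fun j => (K k)`_j) kappa) ?subrK //.
by move=> j /andP[_ jk]; rewrite /kappa -(nK j (k - j)%N) subnKC.
Qed.

End FreeCumulants.

Section Moments.
Variable R : realType.
Implicit Type mu : probability (measurableTypeR R) R.

Local Open Scope classical_set_scope.

Definition msupport mu : set R :=
  [set x | forall U : set R, open U -> U x -> (0 < mu U)%E].

Definition compactly_supported mu : Prop := compact (msupport mu).

Definition moment mu (k : nat) : R := \int[mu]_x (x ^+ k).

Definition moment_series mu : power_series R :=
  PowerSeries (fun k => if k == 0%N then 0 else moment mu k).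

Definition R_series (kappa : nat -> R) : power_series R :=
  PowerSeries (fun k => if k == 0%N then 0 else kappa k).

End Moments.

(* Main.v *)
(** Let S_j(a, b) be the sum of the weights of the noncrossing partitions of the
    interval {a, ..., b-1} in which the block of a, of size s, has weight
    kappa_(s+j) instead of kappa_s.  Let p be the second element of that block:
    noncrossingness makes the elements strictly between a and p an interval
    partitioned on its own, and removing a leaves a noncrossing partition of
    {p, ..., b-1} whose first block has lost one element.  Hence
      S_j(a, b) = kappa_(j+1) N_(b-a-1)
                  + sum_(a < p < b) N_(p-a-1) S_(j+1)(p, b),
    where N_i = [coef_i](1 + M).  The numbers
    sum_(1 <= k <= b-a) kappa_(k+j) [coef_(b-a-k)]((1 + M)^k) satisfy the same
    recursion, by splitting off one factor 1 + M, and the theorem is the case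
    j = 0 of their equality with S_j(a, b). *)

Require Import Defs.
From HB Require Import structures.
From mathcomp Require Import all_boot all_order all_algebra.
From mathcomp Require Import all_classical all_reals all_analysis.
From mathcomp Require Import fintype finset zify.

Set Implicit Arguments.
Unset Strict Implicit.
Unset Printing Implicit Defensive.

Import Order.TTheory GRing.Theory Num.Theory.
Local Open Scope ring_scope.

(** * Sums over set partitions *)

Section PartitionSums.
Variables (T : finType) (V : nmodType).
Implicit Types (A B D : {set T}) (P Q : {set {set T}}).

Lemma partitionU P1 P2 D1 D2 :
  [disjoint D1 & D2] -> partition P1 D1 -> partition P2 D2 ->
  partition (P1 :|: P2) (D1 :|: D2).
Proof.
move=> dD /and3P[/eqP c1 t1 n1] /and3P[/eqP c2 t2 n2]; apply/and3P; split.
- by rewrite -c1 -c2 /cover bigcup_setU.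
- by apply: trivIsetU => //; rewrite c1 c2.
- by rewrite inE negb_or n1.
Qed.

(** A point of [D1] lies in a block that is not inside [D2], hence is inside [D1]. *)
Lemma partition_ssetI P D1 D2 :
  [disjoint D1 & D2] -> partition P (D1 :|: D2) ->
  {in P, forall A, (A \subset D1) || (A \subset D2)} ->
  partition (P ::&: D1) D1.
Proof.
move=> dD partP splitP; apply/and3P; split.
- apply/eqP/setP => x; apply/bigcupP/idP => [[A] | xD].
    by rewrite inE => /andP[_ /subsetP]; apply.
  have: x \in cover P by rewrite (cover_partition partP) inE xD.
  case/bigcupP => A AP xA; exists A => //; rewrite inE AP /=.
  case/orP: (splitP A AP) => // /subsetP/(_ x xA) xD2.
  by rewrite (disjointFr dD xD) in xD2.
- exact/trivIsetI/(partition_trivIset partP).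
- by rewrite inE (partition0 partP).
Qed.

Lemma disjoint_partitions P1 P2 D1 D2 :
  [disjoint D1 & D2] -> partition P1 D1 -> partition P2 D2 ->
  [disjoint P1 & P2].
Proof.
move=> dD p1 p2; apply/pred0P => A /=; apply/andP => -[A1 A2].
have /set0Pn[x xA] := partition_neq0 p1 A1.
have := subsetP (partitionS p2 A2) x xA.
by rewrite (disjointFr dD (subsetP (partitionS p1 A1) x xA)).
Qed.

Lemma partitionU_ssetIl P1 P2 D1 D2 :
  [disjoint D1 & D2] -> partition P1 D1 -> partition P2 D2 ->
  (P1 :|: P2) ::&: D1 = P1.
Proof.
move=> dD p1 p2; apply/setP => A; rewrite !inE.
have [A1|_] /= := boolP (A \in P1); first exact: partitionS A1.
apply/andP => -[A2 AD1]; have /set0Pn[x xA] := partition_neq0 p2 A2.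
have := subsetP (partitionS p2 A2) x xA.
by rewrite (disjointFr dD (subsetP AD1 x xA)).
Qed.

(** Union is a bijection from the pairs [(P1, P2)]; its inverse sorts the blocks by the side that
    contains them. *)
Lemma sum_partition_setU D1 D2 (F : {set {set T}} -> V) :
  [disjoint D1 & D2] ->
  \sum_(P | partition P (D1 :|: D2) &&
            [forall A in P, (A \subset D1) || (A \subset D2)]) F P =
  \sum_(P1 | partition P1 D1) \sum_(P2 | partition P2 D2) F (P1 :|: P2).
Proof.
move=> dD; rewrite pair_big /=.
rewrite (reindex_onto (fun p => p.1 :|: p.2)
           (fun P => (P ::&: D1, P ::&: D2))) /=; last first.
  move=> P /andP[_ /forall_inP splitP]; apply/setP => A; rewrite !inE -andb_orr.
  by have [/splitP ->|] := boolP (A \in P).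
apply: eq_bigl => -[P1 P2] /=; apply/idP/andP => [|[p1 p2]].
  case/andP=> /andP[partP /forall_inP splitP] /eqP[E1 E2]; split.
    by have := partition_ssetI dD partP splitP; rewrite E1.
  rewrite -[P2]E2; apply: (@partition_ssetI _ D2 D1).
  - by rewrite disjoint_sym.
  - by rewrite [D2 :|: D1]setUC.
  - by move=> A /splitP; rewrite orbC.
rewrite partitionU //= xpair_eqE (partitionU_ssetIl dD p1 p2) eqxx.
have -> : (P1 :|: P2) ::&: D2 = P2.
  by rewrite setUC (partitionU_ssetIl _ p2 p1) // disjoint_sym.
rewrite eqxx !andbT.
apply/forall_inP => A /setUP[/(partitionS p1)|/(partitionS p2)] -> //.
by rewrite orbT.
Qed.

(** Partitions are grouped by the block [B] of [x]; deleting [B] leaves an arbitrary partition of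
    [D :\: B]. *)
Lemma sum_partition_block D x (F : {set {set T}} -> V) : x \in D ->
  \sum_(P | partition P D) F P =
  \sum_(B : {set T} | (x \in B) && (B \subset D))
    \sum_(P | partition P (D :\: B)) F (B |: P).
Proof.
move=> xD; have xP P : partition P D -> x \in cover P.
  by move/cover_partition->.
rewrite (partition_big (fun P => pblock P x)
           (fun B => (x \in B) && (B \subset D))) /=; last first.
  move=> P partP; rewrite mem_pblock xP //=.
  by apply: (partitionS partP); rewrite pblock_mem ?xP.
apply: eq_bigr => B /andP[xB BD].
rewrite (reindex_onto (fun P => B |: P) (fun P => P :\ B)) /=; last first.
  by move=> P /andP[/xP Px /eqP <-]; rewrite setD1K ?pblock_mem.
have DE : D = B :|: D :\: B by rewrite -{1}(setID D B) (setIidPr BD).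
apply: eq_bigl => P; apply/idP/idP => [|partP].
  by case/andP=> /andP[partP _] /eqP <-; rewrite partitionD1 ?setU11.
have BP : B \notin P.
  by apply/negP => /(partitionS partP)/subsetP/(_ x xB); rewrite inE xB.
have B0 : B != set0 by apply/set0Pn; exists x.
have partBP : partition (B |: P) D.
  rewrite DE partitionU1 //; apply/pred0P => y.
  by rewrite !inE; case: (y \in B).
rewrite partBP setU1K // eqxx andbT /=; apply/eqP.
by rewrite (@def_pblock _ _ B) ?setU11 ?(partition_trivIset partBP).
Qed.

End PartitionSums.

(** * Crossing blocks *)

Section Noncrossing.
Variable n : nat.
Implicit Types (A B C D : {set 'I_n}) (P Q : {set {set 'I_n}}).

(** Not symmetric: the leftmost of the four points lies in [A]. This is why [uncrossed] tests both
    orders. *)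
Definition crossing A B :=
  [exists a in A, exists b in B, exists c in A, exists d in B,
     [&& a < b, b < c & c < d]%N].

Lemma crossingP A B :
  reflect (exists a b c d : 'I_n, [/\ a \in A, b \in B, c \in A & d \in B] /\
             [/\ a < b, b < c & c < d]%N)
          (crossing A B).
Proof.
apply: (iffP exists_inP) => [[a aA] | [a [b [c [d [[aA bB cA dB] [ab bc cd]]]]]]].
  move=> /exists_inP[b bB] /exists_inP[c cA] /exists_inP[d dB] /and3P[ab bc cd].
  by exists a, b, c, d.
exists a => //; apply/exists_inP; exists b => //; apply/exists_inP.
by exists c => //; apply/exists_inP; exists d => //; apply/and3P.
Qed.

Lemma noncrossing_crossingP P :
  reflect {in P &, forall A B, crossing A B -> A = B} (noncrossing P).
Proof.
apply: (iffP (noncrossingP P)) => H A B AP BP.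
  move=> /crossingP[a [b [c [d [[aA bB cA dB] [ab bc cd]]]]]].
  exact: (H A B AP BP a b c d).
move=> a b c d aA bB cA dB ab bc cd; apply: H => //.
by apply/crossingP; exists a, b, c, d.
Qed.

Definition uncrossed B P := [forall A in P, ~~ crossing A B && ~~ crossing B A].

Lemma uncrossedP B P :
  reflect {in P, forall A, ~~ crossing A B /\ ~~ crossing B A} (uncrossed B P).
Proof.
by apply: (iffP forall_inP) => H A /H /andP.
Qed.

(** No block of [P] equals [B], so every crossing with [B] is forbidden; a set crossing itself is
    harmless. *)
Lemma noncrossingU1 B P : B \notin P ->
  noncrossing (B |: P) = noncrossing P && uncrossed B P.
Proof.
move=> BP; apply/noncrossing_crossingP/andP.
  move=> H; split.
    apply/noncrossing_crossingP => A A' AP A'P.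
    by apply: H; rewrite inE ?AP ?A'P orbT.
  apply/uncrossedP => A AP; have neAB : A != B by apply: contraNneq BP => <-.
  by split; apply/negP => /H E; move: neAB;
    rewrite E ?eqxx // !inE ?eqxx ?AP ?orbT.
case=> /noncrossing_crossingP ncP /uncrossedP unP A A'.
move=> /setU1P[->|AP] /setU1P[->|A'P] //.
- by have [_ /negbTE ->] := unP _ A'P.
- by have [/negbTE -> _] := unP _ AP.
- exact: ncP.
Qed.

(** A crossing uses two distinct points of each set. *)
Lemma uncrossed_set1 x P : uncrossed [set x] P.
Proof.
apply/uncrossedP => A _; split; apply/negP => /crossingP.
  by case=> a [b [c [d [[_ /set1P-> _ /set1P->] []]]]]; lia.
by case=> a [b [c [d [[/set1P-> _ /set1P-> _] []]]]]; lia.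
Qed.

(** Half-open with bounds in [nat], so that [b = n] is allowed. *)
Definition itv a b : {set 'I_n} := [set i : 'I_n | (a <= i < b)%N].

(** * Removal of [a] from a block [a |: C] whose second element is [p] *)

Section Split.
Variables (a p : 'I_n) (b : nat) (C : {set 'I_n}).
Hypotheses (ap : (a < p)%N) (pb : (p < b)%N) (pC : p \in C)
  (Csub : C \subset itv p b).

Let memC x : x \in C -> (p <= x < b)%N.
Proof. by move/(subsetP Csub); rewrite inE. Qed.

Lemma itv_setU1_split :
  itv a b :\: (a |: C) = itv a.+1 p :|: (itv p b :\: C).
Proof.
apply/setP => x; rewrite !inE -val_eqE /=.
by have [/memC|_] /= := boolP (x \in C); lia.
Qed.

Lemma itv_split_disjoint : [disjoint itv a.+1 p & itv p b :\: C].
Proof. by apply/pred0P => x; rewrite !inE; case: (x \in C); lia. Qed.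

(* A block with elements on both sides of [p] would cross [a |: C] at [a], [p]. *)
Lemma uncrossed_split P :
  partition P (itv a b :\: (a |: C)) -> uncrossed (a |: C) P ->
  {in P, forall A, (A \subset itv a.+1 p) || (A \subset itv p b :\: C)}.
Proof.
rewrite itv_setU1_split => partP /uncrossedP unP A AP.
have AD x : x \in A -> x \in itv a.+1 p :|: (itv p b :\: C).
  exact/subsetP/(partitionS partP).
apply/norP => -[/subsetPn[v vA vD] /subsetPn[u uA uD]].
have /and3P[vC pv _] : [&& v \notin C, p <= v & v < b]%N.
  by move: (AD v vA); rewrite inE (negbTE vD) orFb !inE.
have /andP[au up] : (a < u < p)%N.
  by move: (AD u uA); rewrite inE (negbTE uD) orbF inE.
have vp : (p < v)%N.
  by rewrite ltn_neqAle pv andbT; apply: contraNneq vC => /val_inj <-.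
have [_ /negP[]] := unP A AP; apply/crossingP; exists a, u, p, v.
by rewrite !inE pC eqxx orbT.
Qed.

(** Points of [P1] lie strictly between [a] and [p], those of [C] and [P2] at or beyond [p], so
    nothing crosses from one side to the other. In a crossing with a block of [P2], the point [p] of
    [C] can replace [a]. *)
Lemma noncrossing_split P1 P2 :
  partition P1 (itv a.+1 p) -> partition P2 (itv p b :\: C) ->
  noncrossing (P1 :|: P2) && uncrossed (a |: C) (P1 :|: P2) =
  noncrossing P1 && (noncrossing P2 && uncrossed C P2).
Proof.
move=> part1 part2.
have in1 A x : A \in P1 -> x \in A -> (a < x < p)%N.
  by move=> /(partitionS part1)/subsetP H /H; rewrite inE.
have in2 A x : A \in P2 -> x \in A -> (p < x)%N.
  move=> /(partitionS part2)/subsetP H /H; rewrite !inE => /and3P[xC px _].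
  by rewrite ltn_neqAle px andbT; apply: contraNneq xC => /val_inj <-.
apply/andP/and3P => [[/noncrossing_crossingP nc /uncrossedP un]|].
  split.
  - by apply/noncrossing_crossingP => A B AP BP; apply: nc; rewrite inE ?AP ?BP.
  - by apply/noncrossing_crossingP => A B AP BP;
      apply: nc; rewrite inE ?AP ?BP orbT.
  - apply/uncrossedP => A AP; have [|/negP H1 /negP H2] := un A.
      by rewrite inE AP orbT.
    split; apply/negP => /crossingP[x [y [z [w [[? ? ? ?] ?]]]]].
      by apply: H1; apply/crossingP; exists x, y, z, w; rewrite !inE; split=> //;
        split=> //; apply/orP; right.
    by apply: H2; apply/crossingP; exists x, y, z, w; rewrite !inE; split=> //;
        split=> //; apply/orP; right.
case=> /noncrossing_crossingP nc1 /noncrossing_crossingP nc2 /uncrossedP un.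
split.
  apply/noncrossing_crossingP => A B /setUP[A1|A2] /setUP[B1|B2];
    [exact: nc1| | |exact: nc2];
    move=> /crossingP[x [y [z [w [[xA yB zA wB] [xy yz zw]]]]]].
    by have := in1 _ _ A1 zA; have := in2 _ _ B2 yB; clear -xy yz zw; lia.
  by have := in2 _ _ A2 xA; have := in1 _ _ B1 wB; clear -xy yz zw; lia.
apply/uncrossedP => A /setUP[A1|A2].
  (* No point of [a |: C] lies between two points of a block of [P1]. *)
  have inB x : x \in a |: C -> x = a :> nat \/ (p <= x)%N.
    by rewrite !inE => /orP[/eqP ->|/memC/andP[? _]]; [left|right].
  split; apply/negP => /crossingP[x [y [z [w [[xA yB zA wB] [xy yz zw]]]]]].
    by have := in1 _ _ A1 xA; have := in1 _ _ A1 zA; have := inB _ yB; clear -xy yz zw; lia.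
  by have := in1 _ _ A1 yB; have := in1 _ _ A1 wB; have := inB _ zA; clear -xy yz zw; lia.
have [/negP H1 /negP H2] := un A A2.
have inC x : x \in a |: C -> (a < x)%N -> x \in C.
  by rewrite !inE => /orP[/eqP ->|//]; rewrite ltnn.
split; apply/negP => /crossingP[x [y [z [w [[xA yB zA wB] [xy yz zw]]]]]].
  have := in2 _ _ A2 xA => px.
  apply: H1; apply/crossingP; exists x, y, z, w.
  split=> //; split=> //; apply: inC => //; clear -ap px xy yz zw; lia.
have := in2 _ _ A2 yB => py.
(* The first point [x] may be [a]; [p] takes its place because [p \in C] and [p < y]. *)
apply: H2; apply/crossingP; exists p, y, z, w.
split=> //; split=> //; apply: inC => //; clear -ap py yz; lia.
Qed.

End Split.
End Noncrossing.

Lemma coef_mul (R : comNzRingType) (f g : power_series R) n :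
  coef (f * g) n = \sum_(i < n.+1) coef f i * coef g (n - i).
Proof. by []. Qed.

(** * Weighted sums over noncrossing partitions *)

Section Weights.
Variables (R : comNzRingType) (kappa : nat -> R).

Section FixedSize.
Variable n : nat.
Implicit Types (B C D : {set 'I_n}) (P : {set {set 'I_n}}) (a : 'I_n).

Definition ncsum D : R :=
  \sum_(P | partition P D && noncrossing P) \prod_(B in P) kappa #|B|.

(** The weight of [B] itself is left out, so that it can be shifted separately. *)
Definition ncsum_around B D : R :=
  \sum_(P | partition P D && (noncrossing P && uncrossed B P))
    \prod_(A in P) kappa #|A|.

(* The block of [a] is counted as if it had [j] more elements. *)
Definition ncsum_shift j a b : R :=
  \sum_(B : {set 'I_n} | (a \in B) && (B \subset itv n a b))
    kappa (#|B| + j)%N * ncsum_around B (itv n a b :\: B).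

Lemma ncsum_set0 : ncsum set0 = 1.
Proof.
rewrite /ncsum (big_pred1 set0) ?big_set0 // => P.
rewrite partition_set0 /= andb_idr // => /eqP ->.
by apply/noncrossingP => A B; rewrite inE.
Qed.

Lemma ncsum_block D x : x \in D ->
  ncsum D = \sum_(B : {set 'I_n} | (x \in B) && (B \subset D))
              kappa #|B| * ncsum_around B (D :\: B).
Proof.
move=> xD; rewrite /ncsum big_mkcondr (sum_partition_block _ xD).
apply: eq_bigr => B /andP[xB _].
rewrite /ncsum_around [in RHS]big_mkcondr big_distrr /=; apply: eq_bigr => P partP /=.
have BP : B \notin P.
  by apply/negP => /(partitionS partP)/subsetP/(_ x xB); rewrite inE xB.
by rewrite noncrossingU1 // big_setU1 //=; case: ifP; rewrite ?mulr0.
Qed.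

Lemma ncsum_shift0 a b : (a < b)%N -> ncsum (itv n a b) = ncsum_shift 0 a b.
Proof.
move=> ab; rewrite /ncsum_shift (@ncsum_block _ a) ?inE ?leqnn //.
by apply: eq_bigr => B _; rewrite addn0.
Qed.

Lemma ncsum_around_set1 a b :
  ncsum_around [set a] (itv n a b :\: [set a]) = ncsum (itv n a.+1 b).
Proof.
rewrite /ncsum_around (_ : itv n a b :\: [set a] = itv n a.+1 b).
  by apply: eq_bigl => P; rewrite uncrossed_set1 andbT.
by apply/setP => x; rewrite !inE -val_eqE /=; lia.
Qed.

(** A block with points on both sides of [p] would cross [a |: C], so the other blocks form two
    independent partitions and the weights multiply. *)
Lemma ncsum_around_split a (p : 'I_n) b C :
  (a < p)%N -> (p < b)%N -> p \in C -> C \subset itv n p b ->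
  ncsum_around (a |: C) (itv n a b :\: (a |: C)) =
  ncsum (itv n a.+1 p) * ncsum_around C (itv n p b :\: C).
Proof.
move=> ap pb pC Csub; rewrite /ncsum_around.
set D1 := itv n a.+1 p; set D2 := itv n p b :\: C.
(* One-sidedness of the blocks follows from [uncrossed], so it may be added to the range; the
   crossing conditions move into the summand. *)
transitivity (\sum_(P | partition P (D1 :|: D2) &&
    [forall A in P, (A \subset D1) || (A \subset D2)])
  if noncrossing P && uncrossed (a |: C) P
  then \prod_(A in P) kappa #|A| else 0).
  rewrite -big_mkcondr -itv_setU1_split //; apply: eq_bigl => P.
  rewrite -andbA; apply: andb_id2l => partP; rewrite [in RHS]andb_idl //.
  by case/andP=> _ un; apply/forall_inP; apply: uncrossed_split un.
have dD : [disjoint D1 & D2] by exact: itv_split_disjoint.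
rewrite sum_partition_setU // /ncsum [X in _ = X * _]big_mkcondr.
rewrite [X in _ = _ * X]big_mkcondr big_distrlr /=.
apply: eq_bigr => P1 part1; apply: eq_bigr => P2 part2.
rewrite (noncrossing_split ap pC Csub part1 part2).
have -> : \prod_(A in P1 :|: P2) kappa #|A| =
    \prod_(A in P1) kappa #|A| * \prod_(A in P2) kappa #|A|.
  rewrite -bigU; first by apply: eq_bigl => A; rewrite !inE.
  exact: disjoint_partitions part1 part2.
by case: (noncrossing P1); case: (noncrossing P2 && uncrossed C P2); rewrite /= ?mul0r ?mulr0.
Qed.

(** Here [p] is the least element of [B] other than [a], and [C] is [B] without [a]. *)
Lemma sum_subsets_min a b (F : {set 'I_n} -> R) : (a < b)%N ->
  \sum_(B : {set 'I_n} | ((a \in B) && (B \subset itv n a b)) && (B != [set a]))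
    F B =
  \sum_(p : 'I_n | (a < p < b)%N)
    \sum_(C : {set 'I_n} | (p \in C) && (C \subset itv n p b)) F (a |: C).
Proof.
move=> ab; pose least (C : {set 'I_n}) (p : 'I_n) :=
  (p \in C) && [forall y in C, (p <= y)%N].
have least_uniq C p q : least C p -> least C q -> p = q.
  case/andP=> pC /forall_inP pm /andP[qC /forall_inP qm]; apply/val_inj/eqP.
  by rewrite eqn_leq pm ?qm.
(* The default [a] is never reached on the sets summed over, which all have a second element. *)
pose m B := odflt a [pick p | least (B :\ a) p].
have mE B : a \in B -> B != [set a] -> least (B :\ a) (m B).
  move=> aB; rewrite /m; case: pickP => //= noleast /negP[].
  rewrite -(setD1K aB); have [->|/set0Pn[x xB]] := eqVneq (B :\ a) set0.
    by rewrite setU0.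
  case: (arg_minnP (fun i : 'I_n => nat_of_ord i) xB) => p pB pmin.
  by case/negP: (negbT (noleast p)); apply/andP; split=> //; apply/forall_inP.
rewrite (partition_big m (fun p => (a < p < b)%N)) /=; last first.
  move=> B /andP[/andP[aB /subsetP Bs] /(mE B aB)/andP[]].
  by rewrite in_setD1 -val_eqE /= => /andP[na /Bs]; rewrite inE; lia.
apply: eq_bigr => p apb.
rewrite (reindex_onto (fun C => a |: C) (fun B => B :\ a)) /=; last first.
  by move=> B /andP[/andP[/andP[aB _] _] _]; rewrite setD1K.
apply: eq_bigl => C; apply/idP/idP.
  case/andP=> /andP[/andP[/andP[aB /subsetP Bs] B1] /eqP mp] /eqP E.
  have /andP[] := mE _ aB B1; rewrite E mp => pC /forall_inP pm.
  rewrite pC /=.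
  apply/subsetP => x xC; rewrite inE pm //=.
  by have := Bs x; rewrite !inE xC orbT => /(_ isT)/andP[].
case/andP=> pC /subsetP Csub.
have CP x : x \in C -> (p <= x < b)%N by move/Csub; rewrite inE.
have aC : a \notin C by apply/negP => /CP; lia.
have B1 : a |: C != [set a].
  apply/eqP => /setP/(_ p); rewrite !inE pC orbT -val_eqE /=; lia.
rewrite setU1K // eqxx andbT setU11 /= B1 andbT; apply/andP; split.
  by apply/subsetP => x; rewrite !inE => /orP[/eqP->|/CP]; lia.
have := mE _ (setU11 a C) B1; rewrite setU1K // => Lm.
apply/eqP/(least_uniq C) => //; rewrite /least pC.
by apply/forall_inP => y /CP/andP[].
Qed.

(** The block [[set a]] gives the first term. Any other block is [a |: C], and
    [#|a |: C| + j = #|C| + j.+1] turns the shift [j] into [j.+1]. *)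
Lemma ncsum_shift_rec j a b : (a < b)%N ->
  ncsum_shift j a b =
    kappa j.+1 * ncsum (itv n a.+1 b) +
    \sum_(p : 'I_n | (a < p < b)%N)
      ncsum (itv n a.+1 p) * ncsum_shift j.+1 p b.
Proof.
move=> ab; rewrite /ncsum_shift (bigD1 [set a]) /=; last first.
  by rewrite set11 sub1set inE leqnn.
rewrite ncsum_around_set1 cards1 add1n; congr (_ + _).
rewrite sum_subsets_min //; apply: eq_bigr => p /andP[ap pb].
rewrite big_distrr; apply: eq_bigr => C /andP[pC Csub] /=.
rewrite (ncsum_around_split ap pb pC Csub) mulrCA; congr (_ * (_ * _)).
rewrite cardsU1 (_ : a \notin C) ?add1n ?addSnnS //.
by apply/negP => /(subsetP Csub); rewrite inE; lia.
Qed.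

End FixedSize.

Lemma ncsum_NC k :
  \sum_(P in NC k) \prod_(B in P) kappa #|B| = ncsum (itv k 0 k).
Proof.
apply: eq_bigl => P; rewrite inE; congr (partition P _ && _).
by apply/setP => i; rewrite !inE ltn_ord.
Qed.

(** * The same recursion for coefficients of powers of a series *)

Variable M : power_series R.
Hypothesis M0 : coef M 0 = 1.
Hypothesis MNC : forall k, (0 < k)%N -> coef M k = ncsum (itv k 0 k).

(** The index starts at 0, so the exponent is [k.+1]; for [j = 0] this is the right-hand side of the
    theorem. *)
Definition closed_form j l : R :=
  \sum_(k < l) kappa (k.+1 + j)%N * coef (M ^+ k.+1) (l - k.+1).

Lemma closed_form_rec j l :
  closed_form j l.+1 =
    kappa j.+1 * coef M l + \sum_(i < l) coef M i * closed_form j.+1 (l - i).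
Proof.
rewrite /closed_form big_ord_recl; congr (_ + _).
  by rewrite /= add1n subn1.
pose f k i := kappa (k + j).+2 * (coef M i * coef (M ^+ k.+1) (l - i - k.+1)).
(* One factor is split off [M ^+ k.+2]. The index range is the triangle [i + k < l], symmetric in
   [i] and [k], so the sums can be exchanged. *)
transitivity (\sum_(k < l) \sum_(i < l | (i < l - k)%N) f k i).
  apply: eq_bigr => k _; rewrite lift0 exprS coef_mul subSS !addSn.
  have kl := ltn_ord k.
  rewrite big_distrr /= -(big_ord_widen_cond _ (fun=> true) (f k)) ?leq_subr //.
  rewrite -subSn // subSS; apply: eq_bigr => i _; rewrite /f.
  by congr (_ * (_ * coef _ _)); lia.
rewrite (exchange_big_dep xpredT) //=; apply: eq_bigr => i _.
rewrite big_distrr /= (big_ord_widen l (fun k => coef M i *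
  (kappa (k.+1 + j.+1)%N * coef (M ^+ k.+1) (l - i - k.+1)))) ?leq_subr //=.
apply: eq_big => k; first lia.
by move=> _; rewrite /f mulrCA addSn addnS.
Qed.

(** Strong induction on the length [l]. The ambient size [n] varies because the coefficients of [M]
    are sums over the whole of ['I_k]. *)
Lemma ncsum_closed_form l n j (a : 'I_n) b :
  (0 < l)%N -> (b = a + l)%N -> (b <= n)%N ->
  ncsum_shift j a b = closed_form j l.
Proof.
elim/ltn_ind: l n j a b => -[//|l] IH n j a b _ bE bn.
(* Translation invariance: for [i > 0], by induction, both sides equal [closed_form 0 i], whatever
   the position and the ambient size. *)
have ncM i n' c : (i <= l)%N -> (c + i <= n')%N ->
    ncsum (itv n' c (c + i)) = coef M i.
  case: i => [|i] il cn.
    rewrite M0 -(ncsum_set0 n'); congr ncsum; apply/setP => x.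
    by rewrite !inE; lia.
  have c_lt : (c < n')%N by lia.
  rewrite MNC // (@ncsum_shift0 _ (Ordinal c_lt)) ?(@ncsum_shift0 _ ord0) //=;
    last lia.
  by rewrite (IH i.+1) ?(IH i.+1) //=; lia.
rewrite closed_form_rec ncsum_shift_rec; last lia.
rewrite bE addnS -addSn ncM //; last lia.
congr (_ + _).
transitivity (\sum_(p : 'I_n | (a < p < a.+1 + l)%N)
  coef M (p - a.+1) * closed_form j.+1 (l - (p - a.+1))).
  apply: eq_bigr => p apb.
  rewrite -[X in itv n a.+1 X](@subnKC a.+1 p) ?ncM; try lia.
  by rewrite (IH (l - (p - a.+1))%N) //; lia.
(* The sum is reindexed by [i = p - a.+1], the number of points between [a] and [p]. *)
pose g p := coef M (p - a.+1) * closed_form j.+1 (l - (p - a.+1)).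
transitivity (\sum_(a.+1 <= p < a.+1 + l) g p).
  rewrite (@big_nat_widen _ _ _ _ _ n); last by rewrite addSnnS -bE.
  rewrite (@big_nat_widenl _ _ _ _ 0) // big_mkord.
  by apply: eq_bigl => p /=; rewrite andbC.
rewrite -{1}[a.+1]add0n [(a.+1 + l)%N]addnC big_addn addnK big_mkord; apply: eq_bigr => i _.
by rewrite /g addnK.
Qed.

End Weights.

(** * The coefficient identity for the moment series *)

Theorem theorem2p2 (R : realType) (mu : probability (measurableTypeR R) R)
    (kappa : nat -> R) (m : nat) :
  compactly_supported mu ->
  moment_cumulant (moment mu) kappa ->
  (1 <= m)%N ->
  coef (moment_series mu) m =
    \sum_(1 <= k < m.+1)
      coef (R_series kappa) k * coef ((1 + moment_series mu) ^+ k) (m - k).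
Proof.
move=> _ mc m1; set M := 1 + moment_series mu.
have ME k : (0 < k)%N -> coef M k = moment mu k.
  by case: k => //= k _; rewrite add0r.
have M0 : coef M 0 = 1 by rewrite /= addr0.
have MNC k : (0 < k)%N -> coef M k = ncsum kappa (itv k 0 k).
  by move=> k0; rewrite ME // mc // ncsum_NC.
have -> : coef (moment_series mu) m = coef M m.
  by rewrite ME //; case: m m1.
(* [Ordinal m1] is the index 0 of ['I_m], the left end of the whole interval. *)
rewrite MNC // (@ncsum_shift0 _ _ _ (Ordinal m1)) //.
rewrite (ncsum_closed_form M0 MNC 0 m1) // /closed_form.
rewrite big_add1 big_mkord /=; apply: eq_bigr => k _.
by rewrite addn0.
Qed.
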